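(* Let $\Lambda$ be an active partition up to depth $N$, let $w\in\Lambda$ with $|w|<N$, and let $A\in\mathcal{S}_2\cap B(H)_+$. Then $$M_\Lambda(A)-M_{\Lambda[w]}(A)=\delta_w(A).$$ Moreover, $$\delta_w(A)=\sum_{\substack{v,v'\in\mathrm{ch}(w)\\ v\ne v'}}\mathrm{tr}\left(C_v(A)C_{v'}(A)\right)\ge 0,$$ the sum being over ordered pairs. In particular, $M_{\Lambda[w]}(A)\le M_\Lambda(A)$.
   Context: $H$ is a Hilbert space and $B(H)_+$ is the set of bounded positive operators on $H$; $\mathcal{S}_2$ is the Hilbert-Schmidt (HS) class with norm $\|\cdot\|_2$. $\mathcal{T}$ is a rooted finitely branching tree with root $\emptyset$; $|w|$ denotes the depth of a node $w$ and $\mathrm{ch}(w)$ the finite set of children of $w$. $\{W_w\}_{w\in\mathcal{T}}$ is a family of closed subspaces of $H$ with orthogonal projections $P_w$ such that: for each $n\ge 0$, $H=\bigoplus_{|w|=n}W_w$ (orthogonal sum), so $I=\sum_{|w|=n}P_w$; and for each node $w$, $W_w=\bigoplus_{v\in\mathrm{ch}(w)}W_v$ (orthogonal sum), i.e. $P_w=\sum_{v\in\mathrm{ch}(w)}P_v$ with $P_vP_{v'}=0$ for distinct $v,v'\in\mathrm{ch}(w)$. For $A\in B(H)_+$, $C_w(A)=A^{1/2}P_wA^{1/2}$. Fix a terminal depth $N\ge 1$. A finite set $\Lambda\subset\mathcal{T}$ is an active partition up to depth $N$ if (1) each $w\in\Lambda$ satisfies $|w|\le N$; (2) $\Lambda$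 is an antichain (no node of $\Lambda$ is a proper ancestor of another); (3) every node $z\in\mathcal{T}$ with $|z|=N$ has a unique ancestor in $\Lambda$ (a node counts as its own ancestor). For $w\in\Lambda$ with $|w|<N$, the refinement of $\Lambda$ at $w$ is $\Lambda[w]=(\Lambda\setminus\{w\})\cup\mathrm{ch}(w)$. For $A\in\mathcal{S}_2\cap B(H)_+$, define $M_\Lambda(A)=\sum_{w\in\Lambda}\|C_w(A)\|_2^2$ and, for $w\in\Lambda$ with $|w|<N$, $\delta_w(A)=\|C_w(A)\|_2^2-\sum_{v\in\mathrm{ch}(w)}\|C_v(A)\|_2^2$. *)

(* Defs.v *)
From HB Require Import structures.
From mathcomp Require Import all_boot all_order all_algebra.
From mathcomp Require Import finmap complex.
From mathcomp Require Import all_classical all_reals all_analysis.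

Set Implicit Arguments.
Unset Strict Implicit.
Unset Printing Implicit Defensive.

Import Order.TTheory GRing.Theory Num.Theory.
Import numFieldNormedType.Exports.

Local Open Scope classical_set_scope.
Local Open Scope ring_scope.
Local Open Scope complex_scope.

Section HilbertSpace.
Context {R : realType} {H : completeNormedModType R[i]}.
(* The inner product; it is linear in its first argument. *)
Variable ip : {dot H for (@Num.conj R[i])}.

(* A complete normed space whose norm comes from [ip] is a Hilbert space. *)
Definition norm_from_ip := forall x : H, `|x| ^+ 2 = ip x x.

(* Norms take values in [R[i]]; this is the squared norm as an element of [R]. *)
Definition sqnorm (x : H) : R := complex.Re (ip x x).

Definition closed_subspace (V : set H) :=
  [/\ V 0, (forall (a : R[i]) x y, V x -> V y -> V (a *: x + y)) & closed V].

(* The point of [V] nearest to [x], i.e. the [y] in [V] with [x - y]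
   orthogonal to [V]. *)
Definition orth_proj (V : set H) (x : H) : H :=
  xget 0 [set y | V y /\ forall z, V z -> ip (x - y) z = 0].

Definition bounded_op (T : H -> H) :=
  (forall (a : R[i]) x y, T (a *: x + y) = a *: T x + T y) /\
  exists M : R[i], forall x, `|T x| <= M * `|x|.

(* [0 <= z] in [R[i]] means that [z] is real and nonnegative, so that over
   the complex numbers self-adjointness is automatic. *)
Definition positive_op (T : H -> H) :=
  bounded_op T /\ forall x, 0 <= ip (T x) x.

(* The positive square root; a positive operator has exactly one. *)
Definition sqrt_op (A : H -> H) : H -> H :=
  xget (fun=> 0) [set S : H -> H | positive_op S /\ S \o S = A].

Definition lin_span (E : set H) : set H :=
  [set x | exists (F : {fset H}) (c : H -> R[i]),
    [set` F] `<=` E /\ x = \sum_(e <- F) c e *: e].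

Definition orthonormal_basis (E : set H) :=
  (forall e f, E e -> E f -> ip e f = (e == f)%:R) /\
  closure (lin_span E) = [set: H].

(* The basis may be uncountable: [esum] is the supremum of the finite sums. *)
Definition hs_sum (E : set H) (T : H -> H) : \bar R :=
  \esum_(e in E) (sqnorm (T e))%:E.

Definition hilbert_schmidt (E : set H) (T : H -> H) :=
  bounded_op T /\ (hs_sum E T < +oo)%E.

Definition hs_norm (E : set H) (T : H -> H) : R := Num.sqrt (fine (hs_sum E T)).

(* Sum of an absolutely summable real family indexed by [E]. *)
Definition real_sum (E : set H) (f : H -> R) : R :=
  fine (\esum_(e in E) (Num.max (f e) 0)%:E) -
  fine (\esum_(e in E) (Num.max (- f e) 0)%:E).

(* The trace, as the unordered sum of the diagonal entries. *)
Definition trace (E : set H) (T : H -> H) : R[i] :=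
  real_sum E (fun e => complex.Re (ip (T e) e)) +i*
  real_sum E (fun e => complex.Im (ip (T e) e)).

(* [V] is the orthogonal direct sum of the subspaces [W i], [i] in [D]. *)
Definition orth_sum (I : choiceType) (D : {fset I}) (W : I -> set H)
    (V : set H) :=
  (forall i j, i \in D -> j \in D -> i != j ->
     forall x y, W i x -> W j y -> ip x y = 0) /\
  V = [set x | exists2 u : I -> H,
                 (forall i, i \in D -> W i (u i)) & x = \sum_(i <- D) u i].

End HilbertSpace.

(* A finitely branching rooted tree. Increasing depths exclude cycles and make
   every node a descendant of the root. *)
Record rooted_tree := RootedTree {
  node :> choiceType;
  root : node;
  ch : node -> {fset node};
  depth : node -> nat;
  depth_root : depth root = 0%N;
  depth_ch : forall w v, v \in ch w -> depth v = (depth w).+1;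
  unique_parent : forall v, v != root -> exists! w, v \in ch w }.

Section Tree.
Variable T : rooted_tree.

Fixpoint level (n : nat) : {fset T} :=
  if n is m.+1 then (\bigcup_(w <- level m) ch w)%fset else [fset root T]%fset.

Lemma in_level n (w : T) : (w \in level n) = (depth w == n).
Proof.
elim: n w => [|n IHn] w /=.
  rewrite in_fset1; apply/eqP/eqP => [->|w0]; first exact: depth_root.
  apply/eqP; apply/negPn/negP => /unique_parent[u [uw _]].
  by move: w0; rewrite (depth_ch uw).
apply/bigfcupP/eqP => [[u]|wn].
  by rewrite andbT IHn => /eqP <- /depth_ch.
have /unique_parent[u [uw _]] : w != root T.
  by apply/negP => /eqP wr; move: wn; rewrite wr depth_root.
by exists u => //; rewrite andbT IHn; move: wn; rewrite (depth_ch uw) => -[->].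
Qed.

(* Every node is an ancestor of itself. *)
Definition ancestor (u v : T) :=
  exists2 s : seq T, path (fun x y => y \in ch x) u s & v = last u s.

Definition active_partition (N : nat) (L : {fset T}) :=
  [/\ forall w, w \in L -> (depth w <= N)%N,
      forall u v, u \in L -> v \in L -> ancestor u v -> u = v
    & forall z, depth z = N -> exists! u, u \in L /\ ancestor u z].

Definition refinement (L : {fset T}) (w : T) : {fset T} :=
  ((L `\ w) `|` ch w)%fset.

End Tree.

Section Energy.
Context {R : realType} {H : completeNormedModType R[i]}.
Variables (ip : {dot H for (@Num.conj R[i])}) (E : set H).
Variables (T : rooted_tree) (W : T -> set H).

Definition compression (A : H -> H) (w : T) : H -> H :=
  sqrt_op ip A \o orth_proj ip (W w) \o sqrt_op ip A.

Definition energy (A : H -> H) (L : {fset T}) : R :=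
  \sum_(w <- L) hs_norm ip E (compression A w) ^+ 2.

Definition energy_drop (A : H -> H) (w : T) : R :=
  hs_norm ip E (compression A w) ^+ 2 -
  \sum_(v <- ch w) hs_norm ip E (compression A v) ^+ 2.

End Energy.

(* Main.v *)
Require Import Defs.
From HB Require Import structures.
From mathcomp Require Import all_boot all_order all_algebra.
From mathcomp Require Import finmap complex.
From mathcomp Require Import all_classical all_reals all_analysis.
From mathcomp Require Import ring lra.

Set Implicit Arguments.
Unset Strict Implicit.
Unset Printing Implicit Defensive.

Import Order.TTheory GRing.Theory Num.Theory.
Import numFieldNormedType.Exports.

Local Open Scope classical_set_scope.
Local Open Scope ring_scope.
Local Open Scope complex_scope.

(** Write S for the square root of A and C_v = S P_v S. Since S is self-adjoint
and P_v is an orthogonal projection, <C_v x, y> = <P_v S x, P_v S y>: the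
matrix of C_v in an orthonormal basis is a Gram matrix ([dot_compression]).

The refinement at w replaces the node w by its children, none of which lies in
the partition already, so the energy changes by the drop at w
([sum_refinement]). As P_w is the sum of the P_v over the children v of w, C_w
is the sum of the C_v ([compression_sum]). Expanding |C_w e|^2 and using <C_v'
e, C_v e> = <C_v C_v' e, e> leaves, besides the squares |C_v e|^2, the diagonal
entries of the C_v C_v' with v <> v'; summing over the basis gives the formula
for the drop ([hs_norm_sum_sub]).

Two analytic facts remain: every C_v is Hilbert-Schmidt, so that all these sums
converge, and the drop is nonnegative. Both come from one finite-dimensional
fact, that the trace of a product of two positive semidefinite matrices is
nonnegative ([gram_cross_ge0]). It makes the squared Frobenius norm
superadditive on Gram matrices, hence the squared Hilbert-Schmidt norm
superadditive on operators with Gram kernels ([hs_sum_superadditive]): a finite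
block of the matrix suffices, because Bessel bounds the blocks of the sum and
Parseval recovers each summand from its blocks. For C_w, the sum of the C_v,
this bounds the sum of the |C_v|_2^2 by |C_w|_2^2, so the drop is nonnegative.
For A = S P_v S + S (1 - P_v) S it bounds |C_v|_2 by |A|_2. *)

(** * Gram kernels *)

Section GramKernels.
Context {R : realType} {H : completeNormedModType R[i]}.
Variable ip : {dot H for (@Num.conj R[i])}.

Lemma dotC x y : ip x y = Num.conj (ip y x).
Proof. by rewrite hermC expr0 mul1r. Qed.

Lemma dotZl c x y : ip (c *: x) y = c * ip x y.
Proof. exact: linearZl_LR. Qed.

Lemma dotZr c x y : ip x (c *: y) = Num.conj c * ip x y.
Proof. exact: linearZr_LR. Qed.

Lemma sqnormE x : (sqnorm ip x)%:C = ip x x.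
Proof. by rewrite /sqnorm RRe_real// ger0_real// dnorm_ge0. Qed.

(** The Gram matrices of the families a and b are positive semidefinite, and
this is the trace of their product. Induction on the index list, by one step of
Gram-Schmidt: splitting off from every a e its component along a x kills a x,
and contributes a rank-one kernel, whose sum is a square norm. *)
Lemma gram_cross_ge0 (I : Type) (s : seq I) (a b : I -> H) :
  0 <= \sum_(e <- s) \sum_(f <- s) ip (a e) (a f) * ip (b f) (b e).
Proof.
elim: s a => [|x s IHs] a; first by rewrite big_nil.
pose n := ip (a x) (a x); pose c e := ip (a e) (a x) / n.
pose a' e := a e - c e *: a x.
have n0E : n = 0 -> a x = 0 by move=> /eqP; rewrite dnorm_eq0 => /eqP.
have a'x : a' x = 0.
  rewrite /a' /c; have [/n0E ->|n0] := eqVneq n 0.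
    by rewrite scaler0 subr0.
  by rewrite divff// scale1r subrr.
have cn e : c e * n = ip (a e) (a x).
  rewrite /c; have [n0|n0] := eqVneq n 0; last by rewrite divfK.
  by rewrite n0 mulr0 n0E// linear0r.
have nc e : n * Num.conj (c e) = ip (a x) (a e).
  have -> : n = Num.conj n by rewrite /n -dotC.
  by rewrite mulrC -rmorphM/= cn -dotC.
(* The kernel of a is that of a' plus a rank-one kernel. *)
have a'E e f : ip (a e) (a f) = ip (a' e) (a' f) + c e * n * Num.conj (c f).
  by rewrite /a' linearBl !linearBr/= !dotZl !dotZr -/n -nc -cn; ring.
under eq_bigr do under eq_bigr do rewrite a'E mulrDl.
under eq_bigr do rewrite big_split/=.
rewrite big_split/= addr_ge0//.
  rewrite big_cons big1 ?add0r; last by move=> f _; rewrite a'x linear0l mul0r.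
  under eq_bigr do rewrite big_cons a'x linear0r mul0r add0r.
  exact: IHs.
pose g := \sum_(f <- x :: s) Num.conj (c f) *: b f.
suff -> : \sum_(e <- x :: s) \sum_(f <- x :: s)
    c e * n * Num.conj (c f) * ip (b f) (b e) = n * ip g g.
  by rewrite mulr_ge0// dnorm_ge0.
rewrite {2}/g linear_sumr/= mulr_sumr; apply: eq_bigr => e _.
rewrite dotZr conjCK /g linear_sumlz/= !mulr_sumr.
apply: eq_bigr => f _; rewrite dotZl; ring.
Qed.

Definition normc2 (z : R[i]) : R := complex.Re z ^+ 2 + complex.Im z ^+ 2.

Lemma normc2E z : (normc2 z)%:C = z * Num.conj z.
Proof. by rewrite /normc2 add_Re2_Im2 normCK. Qed.

(** The squared Frobenius norm of a sum of Gram matrices exceeds the sum of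
their squared norms by the cross terms, which [gram_cross_ge0] makes
nonnegative. *)
Lemma gram_superadditive (I K : Type) (s : seq I) (r : seq K)
    (a : K -> I -> H) :
  \sum_(k <- r) \sum_(e <- s) \sum_(f <- s) normc2 (ip (a k e) (a k f)) <=
  \sum_(e <- s) \sum_(f <- s) normc2 (\sum_(k <- r) ip (a k e) (a k f)).
Proof.
elim: r => [|x r IHr].
  rewrite big_nil sumr_ge0// => e _; rewrite sumr_ge0// => f _.
  by rewrite addr_ge0// sqr_ge0.
rewrite big_cons; apply: le_trans (lerD (lexx _) IHr) _.
rewrite -lecR -subr_ge0 !rmorphD/= !rmorph_sum/= -big_split/= -sumrB.
pose q e f := \sum_(k <- r) ip (a k e) (a k f).
have qC e f : Num.conj (q e f) = q f e.
  by rewrite /q rmorph_sum/=; apply: eq_bigr => k _; rewrite -dotC.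
have cross : 0 <= \sum_(e <- s) \sum_(f <- s) ip (a x e) (a x f) * q f e.
  rewrite /q; under eq_bigr do under eq_bigr do rewrite mulr_sumr.
  under eq_bigr do rewrite exchange_big/=.
  by rewrite exchange_big/= sumr_ge0// => k _; apply: gram_cross_ge0.
suff -> : \sum_(e <- s) ((\sum_(f <- s)
      normc2 (\sum_(k <- x :: r) ip (a k e) (a k f)))%:C -
    ((\sum_(f <- s) normc2 (ip (a x e) (a x f)))%:C +
     (\sum_(f <- s) normc2 (q e f))%:C)) =
  \sum_(e <- s) \sum_(f <- s) ip (a x e) (a x f) * q f e +
  Num.conj (\sum_(e <- s) \sum_(f <- s) ip (a x e) (a x f) * q f e).
  by rewrite addr_ge0// conjC_ge0.
rewrite rmorph_sum/= -big_split/=; apply: eq_bigr => e _.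
rewrite rmorph_sum/= !rmorph_sum/= -!big_split/= -sumrB; apply: eq_bigr => f _.
rewrite !normc2E big_cons -/(q e f) !rmorphD rmorphM/= -!dotC !qC; ring.
Qed.
End GramKernels.

(** * Bessel, Parseval and Hilbert-Schmidt sums *)

Section ESum.
Context {R : realType} {T : choiceType}.
Variables (D : set T) (a : T -> \bar R).

Lemma fset_sum_le_esum (F : {fset T}) : [set` F] `<=` D ->
  (\sum_(e <- F) a e <= \esum_(e in D) a e)%E.
Proof.
move=> FD; apply: esum_ge; exists [set` F]; first by split.
by rewrite fsbig_finite//= set_fsetK.
Qed.

Lemma esum_le_fset_sum (M : \bar R) :
  (forall F : {fset T}, [set` F] `<=` D -> (\sum_(e <- F) a e <= M)%E) ->
  (\esum_(e in D) a e <= M)%E.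
Proof.
move=> FM; apply: ge_ereal_sup => _ [X [finX XD] <-].
by rewrite fsbig_finite//; apply: FM => x /=; rewrite in_fset_set// inE => /XD.
Qed.
End ESum.

Section OrthonormalBasis.
Context {R : realType} {H : completeNormedModType R[i]}.
Variable ip : {dot H for (@Num.conj R[i])}.
Hypothesis hH : norm_from_ip ip.
Variable E : set H.
Hypothesis hE : orthonormal_basis ip E.

Lemma normc2_ge0 (z : R[i]) : 0 <= normc2 z.
Proof. by rewrite addr_ge0// sqr_ge0. Qed.

Lemma sqnorm_ge0 x : 0 <= sqnorm ip x.
Proof. by rewrite -ler0c sqnormE dnorm_ge0. Qed.

(** Completing the square in each coefficient: the last sum is the price of using
c e in place of the Fourier coefficient <x, e>. *)
Lemma sqnorm_dist_lin_comb (F : {fset H}) c x : [set` F] `<=` E ->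
  sqnorm ip (x - \sum_(e <- F) c e *: e) =
  sqnorm ip x - \sum_(e <- F) normc2 (ip x e)
  + \sum_(e <- F) normc2 (ip x e - c e).
Proof.
move=> FE; apply: complexI; rewrite rmorphD rmorphB/= !rmorph_sum/= !sqnormE.
set y := \sum_(e <- F) c e *: e.
have xy : ip x y = \sum_(e <- F) Num.conj (c e) * ip x e.
  by rewrite linear_sumr/=; apply: eq_bigr => e _; rewrite dotZr.
have ey e : e \in F -> ip e y = Num.conj (c e).
  move=> eF; rewrite linear_sumr/= (bigD1_seq e)//= dotZr.
  rewrite hE.1 ?eqxx ?mulr1; [|exact: FE|exact: FE].
  rewrite big_seq_cond big1 ?addr0// => f /andP[fF fe].
  by rewrite dotZr hE.1 ?(eq_sym e) ?(negbTE fe) ?mulr0//; exact: FE.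
rewrite linearBl !linearBr/= xy (dotC _ y x) xy rmorph_sum/=.
rewrite [ip y y]linear_sumlz/= -[LHS]addrA -[RHS]addrA; congr (_ + _).
rewrite addrC -!sumrB -!sumrN -!big_split/= big_seq [RHS]big_seq.
apply: eq_bigr => e eF; rewrite !normc2E dotZl (ey _ eF).
by rewrite !rmorphM !rmorphB/= !conjCK; ring.
Qed.

Lemma bessel (F : {fset H}) x : [set` F] `<=` E ->
  \sum_(e <- F) normc2 (ip x e) <= sqnorm ip x.
Proof.
move=> FE; have := sqnorm_ge0 (x - \sum_(e <- F) ip x e *: e).
rewrite sqnorm_dist_lin_comb// [X in _ + X]big1 ?addr0 ?subr_ge0// => e _.
by rewrite subrr /normc2/= expr0n addr0.
Qed.

(** The span of the basis contains combinations arbitrarily close to x, and the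
Fourier coefficients do at least as well as any of them. *)
Lemma parseval x :
  (sqnorm ip x)%:E = \esum_(e in E) (normc2 (ip x e))%:E.
Proof.
apply/eqP; rewrite eq_le; apply/andP; split; last first.
  by apply: esum_le_fset_sum => F FE; rewrite sumEFin lee_fin bessel.
apply/lee_addgt0Pr => d d0.
have : closure (lin_span E) x by rewrite hE.2.
have sd0 : 0 < (Num.sqrt d)%:C :> R[i] by rewrite ltcR sqrtr_gt0.
move=> /(_ _ (nbhsx_ballx x _ sd0))[_ [[F [c [FE ->]]]]].
rewrite -ball_normE /= => xy.
apply: (@le_trans _ _ ((\sum_(e <- F) normc2 (ip x e)) + d)%:E); last first.
  by rewrite EFinD leeD2r// -sumEFin; apply: fset_sum_le_esum.
rewrite lee_fin addrC -lerBlDr.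
apply: (@le_trans _ _ (sqnorm ip (x - \sum_(e <- F) c e *: e))).
  by rewrite sqnorm_dist_lin_comb// lerDl sumr_ge0// => e _; exact: normc2_ge0.
rewrite -lecR sqnormE -hH -[in leRHS](sqr_sqrtr (ltW d0)) rmorphXn/=.
by rewrite lerXn2r ?nnegrE// ltW.
Qed.

(** By Parseval the left-hand side is the supremum, over finite F and F', of sums
of squared matrix entries over F x F'. Such a sum grows when F and F' are both
replaced by their union G; over the square G x G the entries form Gram matrices,
and Bessel bounds the block of U by the norms of its columns. *)
Lemma hs_sum_superadditive (K : choiceType) (r : seq K) (T : K -> H -> H)
    (a : K -> H -> H) (U : H -> H) :
  (forall k x y, ip (T k x) y = ip (a k x) (a k y)) ->
  (forall x, U x = \sum_(k <- r) T k x) ->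
  (\sum_(k <- r) hs_sum ip E (T k) <= hs_sum ip E U)%E.
Proof.
move=> Ta UT; pose g k e f := normc2 (ip (T k e) f).
have g0 k e f : (0 <= (g k e f)%:E)%E by rewrite lee_fin normc2_ge0.
rewrite /hs_sum -esum_sum; last by move=> e k _ _; rewrite lee_fin sqnorm_ge0.
apply: esum_le_fset_sum => F FE.
under eq_bigr do under eq_bigr do rewrite parseval.
under eq_bigr do (rewrite -esum_sum; last by move=> f k _ _; exact: g0).
rewrite -esum_sum; last by move=> f e _ _; rewrite sume_ge0// => k _; exact: g0.
apply: esum_le_fset_sum => F' F'E; pose G := (F `|` F')%fset.
have GE : [set` G] `<=` E by move=> e /=; rewrite inE => /orP[/FE|/F'E].
apply: (@le_trans _ _
    (\sum_(f <- G) \sum_(e <- G) \sum_(k <- r) (g k e f)%:E)%E).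
  apply: (@le_trans _ _
      (\sum_(f <- F') \sum_(e <- G) \sum_(k <- r) (g k e f)%:E)%E).
    apply: lee_sum => f _; apply: lee_sum_nneg_subfset => e.
      by move=> eF; rewrite in_fsetU eF.
    by move=> _ _; apply: sume_ge0 => k _; exact: g0.
  apply: lee_sum_nneg_subfset => f.
    by move=> fF; rewrite in_fsetU fF orbT.
  by move=> _ _; apply: sume_ge0 => e _; apply: sume_ge0 => k _; exact: g0.
apply: (@le_trans _ _ (\sum_(e <- G) \sum_(f <- G) (normc2 (ip (U e) f)))%:E).
  have -> : (\sum_(f <- G) \sum_(e <- G) \sum_(k <- r) (g k e f)%:E)%E =
      (\sum_(k <- r) \sum_(e <- G) \sum_(f <- G) g k e f)%:E.
    rewrite exchange_big [in RHS]exchange_big/= -sumEFin.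
    apply: eq_bigr => e _; rewrite [in RHS]exchange_big/= -sumEFin.
    by apply: eq_bigr => f _; rewrite sumEFin.
  rewrite lee_fin /g; under eq_bigr do under eq_bigr do under eq_bigr do
    rewrite Ta.
  apply: le_trans (gram_superadditive ip G r a) _.
  apply: ler_sum => e _; apply: ler_sum => f _; under eq_bigr do rewrite -Ta.
  by rewrite UT linear_sumlz.
apply: (@le_trans _ _ (\sum_(e <- G) (sqnorm ip (U e))%:E)%E).
  by rewrite sumEFin lee_fin; apply: ler_sum => e _; exact: bessel.
exact: fset_sum_le_esum.
Qed.
End OrthonormalBasis.

(** * Unordered sums of signed families *)

Section RealSum.
Context {R : realType} {H : completeNormedModType R[i]}.
Variable E : set H.

Definition nneg_summable (p : H -> R) :=
  (forall e, E e -> 0 <= p e) /\ (\esum_(e in E) (p e)%:E < +oo)%E.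

Lemma nneg_summable_fin_num p : nneg_summable p ->
  (\esum_(e in E) (p e)%:E)%E \is a fin_num.
Proof.
move=> [p0 poo]; rewrite ge0_fin_numE//.
by apply: esum_ge0 => e Ee; rewrite lee_fin p0.
Qed.

Lemma nneg_summable_le p q : (forall e, E e -> 0 <= p e <= q e) ->
  nneg_summable q -> nneg_summable p.
Proof.
move=> pq [q0 qoo]; split=> [e /pq/andP[]//|]; apply: le_lt_trans qoo.
by apply: le_esum => e /pq/andP[_]; rewrite lee_fin.
Qed.

Lemma esum_fineD p q : nneg_summable p -> nneg_summable q ->
  fine (\esum_(e in E) (p e + q e)%:E) =
  fine (\esum_(e in E) (p e)%:E) + fine (\esum_(e in E) (q e)%:E).
Proof.
move=> ps qs; rewrite -fineD ?nneg_summable_fin_num// -esumD//.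
- by move=> e Ee; rewrite lee_fin ps.1.
- by move=> e Ee; rewrite lee_fin qs.1.
Qed.

Lemma nneg_summableD p q : nneg_summable p -> nneg_summable q ->
  nneg_summable (fun e => p e + q e).
Proof.
move=> ps qs; split=> [e Ee|]; first by rewrite addr_ge0 ?ps.1 ?qs.1.
under eq_esum do rewrite EFinD.
rewrite esumD; first exact: lte_add_pinfty ps.2 qs.2.
- by move=> e Ee; rewrite lee_fin ps.1.
- by move=> e Ee; rewrite lee_fin qs.1.
Qed.

(** The sum does not depend on how f is written as a difference of nonnegative
summable families: its positive and negative parts are one such pair, and two
pairs with the same difference have equal cross sums. *)
Lemma real_sumB f p q : nneg_summable p -> nneg_summable q ->
  (forall e, E e -> f e = p e - q e) ->
  real_sum E f =
  fine (\esum_(e in E) (p e)%:E) - fine (\esum_(e in E) (q e)%:E).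
Proof.
move=> ps qs fE.
have mp : nneg_summable (fun e => Num.max (f e) 0).
  apply: (nneg_summable_le _ ps) => e Ee; rewrite fE//; apply/andP; split.
    by rewrite le_max lexx orbT.
  by rewrite ge_max ps.1// lerBlDr lerDl qs.1.
have mn : nneg_summable (fun e => Num.max (- f e) 0).
  apply: (nneg_summable_le _ qs) => e Ee; rewrite fE//; apply/andP; split.
    by rewrite le_max lexx orbT.
  by rewrite ge_max qs.1// opprB lerBlDr lerDl ps.1.
apply/eqP; rewrite /real_sum subr_eq addrAC eq_sym subr_eq -!esum_fineD//.
apply/eqP; congr fine; apply: eq_esum => e Ee; congr EFin.
rewrite fE//.
by case: (ltrP (p e - q e) 0) => ?; case: (ltrP (- (p e - q e)) 0) => ?; lra.
Qed.

Definition abs_summable (f : H -> R) := nneg_summable (fun e => `|f e|).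

Lemma real_sumD f g : abs_summable f -> abs_summable g ->
  real_sum E (fun e => f e + g e) = real_sum E f + real_sum E g.
Proof.
have pos h : abs_summable h -> nneg_summable (fun e => Num.max (h e) 0).
  move=> hs; apply: (nneg_summable_le _ hs) => e Ee.
  by rewrite le_max lexx orbT ge_max ler_norm normr_ge0.
have neg h : abs_summable h -> nneg_summable (fun e => Num.max (- h e) 0).
  move=> hs; apply: (nneg_summable_le _ hs) => e Ee.
  by rewrite le_max lexx orbT ge_max -normrN ler_norm normr_ge0.
move=> fs gs.
rewrite (real_sumB (nneg_summableD (pos _ fs) (pos _ gs))
                   (nneg_summableD (neg _ fs) (neg _ gs))).
  by rewrite !esum_fineD; [rewrite /real_sum; ring|exact: neg|exact: neg|
                           exact: pos|exact: pos].
move=> e _.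
by case: (ltrP (f e) 0) => ?; case: (ltrP (- f e) 0) => ?;
   case: (ltrP (g e) 0) => ?; case: (ltrP (- g e) 0) => ?; lra.
Qed.

Lemma abs_summable0 : abs_summable (fun=> 0).
Proof.
split=> [e _|]; first by rewrite normr0.
by rewrite esum1// => e _; rewrite normr0.
Qed.

Lemma abs_summableD f g : abs_summable f -> abs_summable g ->
  abs_summable (fun e => f e + g e).
Proof.
move=> fs gs; apply: (nneg_summable_le _ (nneg_summableD fs gs)) => e _.
by rewrite normr_ge0 ler_normD.
Qed.

Lemma abs_summable_sum (K : Type) (r : seq K) (P : pred K) (f : K -> H -> R) :
  (forall k, abs_summable (f k)) ->
  abs_summable (fun e => \sum_(k <- r | P k) f k e).
Proof.
move=> fs; elim: r => [|k r IHr].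
  by under eq_fun do rewrite big_nil; exact: abs_summable0.
under eq_fun do rewrite big_cons; case: (P k) => //.
exact: abs_summableD.
Qed.

Lemma real_sum_sum (K : Type) (r : seq K) (P : pred K) (f : K -> H -> R) :
  (forall k, abs_summable (f k)) ->
  \sum_(k <- r | P k) real_sum E (f k) =
  real_sum E (fun e => \sum_(k <- r | P k) f k e).
Proof.
move=> fs; elim: r => [|k r IHr].
  rewrite big_nil; under [in RHS]eq_fun do rewrite big_nil.
  rewrite /real_sum !esum1 ?subrr// => e _; rewrite ?oppr0 maxxx//.
rewrite big_cons; under [in RHS]eq_fun do rewrite big_cons; case: (P k) => //.
by rewrite real_sumD// ?IHr//; exact: abs_summable_sum.
Qed.
End RealSum.

(** * The Hilbert-Schmidt norm of a sum and its traces *)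

Section Trace.
Context {R : realType} {H : completeNormedModType R[i]}.
Variable ip : {dot H for (@Num.conj R[i])}.
Variable E : set H.

Lemma Re_dot_le x y : `|complex.Re (ip x y)| <= sqnorm ip x + sqnorm ip y.
Proof.
have D z : sqnorm ip (x + z) =
    sqnorm ip x + sqnorm ip z + complex.Re (ip x z) *+ 2.
  rewrite /sqnorm linearDl !linearDr/= (dotC _ z x).
  by case: (ip x x) (ip z z) (ip x z) => [? ?] [? ?] [? ?] /=; ring.
have := sqnorm_ge0 ip (x + y); have := sqnorm_ge0 ip (x + - y).
have -> : sqnorm ip (x - y) =
    sqnorm ip x + sqnorm ip y - complex.Re (ip x y) *+ 2.
  rewrite D /sqnorm linearNl !linearNr opprK/=.
  by case: (ip x y) => ? ? /=; ring.
rewrite D; have := sqnorm_ge0 ip x; have := sqnorm_ge0 ip y.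
by rewrite ler_norml => ? ? ? ?; apply/andP; split; lra.
Qed.

Lemma Im_dot_le x y : `|complex.Im (ip x y)| <= sqnorm ip x + sqnorm ip y.
Proof.
(* The imaginary part of <x, y> is the real part of <x, i y>. *)
have := Re_dot_le x ('i%C *: y).
rewrite /sqnorm dotZl !dotZr.
case: (ip x x) (ip y y) (ip x y) => [a a'] [b b'] [c d] /=.
by rewrite !mul0r !mul1r !mulN1r !opprK !sub0r add0r opprK.
Qed.

Lemma sum_complex (K : Type) (r : seq K) (P : pred K) (a b : K -> R) :
  \sum_(k <- r | P k) (a k +i* b k) =
  (\sum_(k <- r | P k) a k) +i* (\sum_(k <- r | P k) b k).
Proof.
elim: r => [|k r IHr]; first by rewrite !big_nil.
by rewrite !big_cons IHr; case: (P k).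
Qed.

Lemma hs_sum_ge0 T : (0 <= hs_sum ip E T)%E.
Proof. by apply: esum_ge0 => e _; rewrite lee_fin sqnorm_ge0. Qed.

Lemma sqr_hs_norm T : hs_norm ip E T ^+ 2 = fine (hs_sum ip E T).
Proof. by rewrite sqr_sqrtr// fine_ge0// hs_sum_ge0. Qed.

Lemma sqnorm_sum_offdiag (K : eqType) (r : seq K) (x : K -> H) : uniq r ->
  \sum_(k <- r) \sum_(l <- r | k != l) ip (x l) (x k) =
  (sqnorm ip (\sum_(k <- r) x k) - \sum_(k <- r) sqnorm ip (x k))%:C.
Proof.
move=> ur; rewrite rmorphB/= rmorph_sum/= sqnormE linear_sumr/= -sumrB.
rewrite big_seq [RHS]big_seq; apply: eq_bigr => k kr.
rewrite linear_sumlz sqnormE (bigD1_seq k)//= addrC addrK.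
by apply: eq_bigl => l; rewrite eq_sym.
Qed.

(** The identity of [sqnorm_sum_offdiag] for the vectors T k e, summed over the
basis. Self-adjointness turns <T l e, T k e> into a diagonal entry of T k T l;
the off-diagonal total is real at each e, since the pairs (k, l) and (l, k)
contribute conjugate numbers. *)
Lemma hs_norm_sum_sub (K : choiceType) (r : seq K) (T : K -> H -> H)
    (U : H -> H) :
  uniq r ->
  (forall k x y, ip (T k x) y = ip x (T k y)) ->
  (forall k, hs_sum ip E (T k) < +oo)%E ->
  (forall x, U x = \sum_(k <- r) T k x) -> (hs_sum ip E U < +oo)%E ->
  (hs_norm ip E U ^+ 2 - \sum_(k <- r) hs_norm ip E (T k) ^+ 2)%:C =
  \sum_(k <- r) \sum_(l <- r | k != l) trace ip E (T k \o T l).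
Proof.
move=> ur Tsa Ths UT Uhs.
have sq V : (hs_sum ip E V < +oo)%E ->
    nneg_summable E (fun e => sqnorm ip (V e)).
  by move=> Voo; split=> // e _; exact: sqnorm_ge0.
have re k l : abs_summable E (fun e => complex.Re (ip ((T k \o T l) e) e)).
  apply: (nneg_summable_le _ (nneg_summableD (sq _ (Ths l)) (sq _ (Ths k)))).
  by move=> e _; rewrite normr_ge0/= Tsa Re_dot_le.
have im k l : abs_summable E (fun e => complex.Im (ip ((T k \o T l) e) e)).
  apply: (nneg_summable_le _ (nneg_summableD (sq _ (Ths l)) (sq _ (Ths k)))).
  by move=> e _; rewrite normr_ge0/= Tsa Im_dot_le.
under [RHS]eq_bigr do rewrite sum_complex !real_sum_sum//.
rewrite sum_complex !real_sum_sum; [|by move=> k; exact: abs_summable_sum..].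
have off e : \sum_(k <- r) \sum_(l <- r | k != l) ip ((T k \o T l) e) e =
    (sqnorm ip (U e) - \sum_(k <- r) sqnorm ip (T k e))%:C.
  rewrite UT -sqnorm_sum_offdiag//; apply: eq_bigr => k _.
  by apply: eq_bigr => l _ /=; rewrite Tsa.
have split_off e : \sum_(k <- r) \sum_(l <- r | k != l) ip ((T k \o T l) e) e =
    (\sum_(k <- r) \sum_(l <- r | k != l) complex.Re (ip ((T k \o T l) e) e))
    +i*
    (\sum_(k <- r) \sum_(l <- r | k != l) complex.Im (ip ((T k \o T l) e) e)).
  rewrite -sum_complex; apply: eq_bigr => k _; rewrite -sum_complex.
  by apply: eq_bigr => l _; case: (ip _ _).
have both e := etrans (esym (split_off e)) (off e).
have Tsq : nneg_summable E (fun e => \sum_(k <- r) sqnorm ip (T k e)).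
  have -> : (fun e => \sum_(k <- r) sqnorm ip (T k e)) =
      (fun e => `|\sum_(k <- r) sqnorm ip (T k e)|).
    apply/funext => e; rewrite ger0_norm// sumr_ge0// => k _.
    exact: sqnorm_ge0.
  apply: abs_summable_sum => k; rewrite /abs_summable.
  under eq_fun do rewrite ger0_norm ?sqnorm_ge0//.
  exact: sq.
congr (_ +i* _).
  rewrite (real_sumB (sq _ Uhs) Tsq); last by move=> e _; case: (both e).
  rewrite sqr_hs_norm; congr (_ - _).
  under [X in _ = fine X]eq_esum do rewrite -sumEFin.
  rewrite esum_sum; last by move=> e k _ _; rewrite lee_fin sqnorm_ge0.
  rewrite -sum_fine; last first.
    by move=> k _; exact: nneg_summable_fin_num (sq _ (Ths k)).
  by apply: eq_bigr => k _; rewrite sqr_hs_norm.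
rewrite (real_sumB (sq _ Uhs) (sq _ Uhs)) ?subrr// => e _.
by case: (both e) => _ ->; rewrite subrr.
Qed.
End Trace.

(** * Positive operators and their square roots *)

Section Positive.
Context {R : realType} {H : completeNormedModType R[i]}.
Variable ip : {dot H for (@Num.conj R[i])}.

Lemma bounded_opD (S : H -> H) x y : bounded_op S -> S (x + y) = S x + S y.
Proof. by move=> [Slin _]; have := Slin 1 x y; rewrite !scale1r. Qed.

Lemma bounded_op0 (S : H -> H) : bounded_op S -> S 0 = 0.
Proof. by move=> Sb; apply: (addIr (S 0)); rewrite -bounded_opD// !add0r. Qed.

(** Polarization: the quadratic form is real at x, y, x + y and x + i y, and
the last two give the imaginary and the real part of the identity. *)
Lemma positive_op_selfadjoint (S : H -> H) : positive_op ip S ->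
  forall x y, ip (S x) y = ip x (S y).
Proof.
move=> [Sb S0] x y; have [Slin _] := Sb.
have SD u v : S (u + v) = S u + S v by exact: bounded_opD.
have SZ c u : S (c *: u) = c *: S u.
  by have := Slin c u 0; rewrite (bounded_op0 Sb) !addr0.
have im u : complex.Im (ip (S u) u) = 0 by apply: ger0_Im.
rewrite (dotC _ x (S y)).
have := im x; have := im y; have := im (x + y); have := im (x + 'i%C *: y).
rewrite !SD !SZ !linearDl !linearDr/= !dotZl !dotZr.
case: (ip (S x) x) (ip (S y) y) (ip (S x) y) (ip (S y) x)
  => [a a'] [b b'] [c c'] [d d'] /=.
move=> h1 h2 h3 h4; congr (_ +i* _); lra.
Qed.

(** A positive square root is positive by choice, and the default value, the
zero operator, is positive too. *)
Lemma positive_sqrt_op A : positive_op ip (sqrt_op ip A).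
Proof.
rewrite /sqrt_op; case: xgetP => [S _ []//|_]; split.
  split=> [a x y|]; first by rewrite scaler0 addr0.
  by exists 0 => x; rewrite normr0 mul0r.
by move=> x; rewrite linear0l.
Qed.

Lemma hs_sum_sqrt_op (E : set H) A : (hs_sum ip E A < +oo)%E ->
  (hs_sum ip E (sqrt_op ip A \o sqrt_op ip A) < +oo)%E.
Proof.
rewrite /sqrt_op; case: xgetP => [S _ [_ ->]//|_ _].
by rewrite /hs_sum esum1// => e _ /=; rewrite /sqnorm linear0l.
Qed.
End Positive.

(** * Orthogonal projections *)

Section Projection.
Context {R : realType} {H : completeNormedModType R[i]}.
Variable ip : {dot H for (@Num.conj R[i])}.

Definition is_orth_proj (V : set H) (x y : H) :=
  V y /\ forall z, V z -> ip (x - y) z = 0.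

(** Here this property comes from a decomposition of the whole space of which V
is a summand. *)
Definition proximinal (V : set H) := forall x, exists y, is_orth_proj V x y.

Lemma orth_projP V x : proximinal V -> is_orth_proj V x (orth_proj ip V x).
Proof.
move=> /(_ x)[y xy]; rewrite /orth_proj; case: xgetP => [z -> //|no].
by case: (no y).
Qed.

Lemma orth_proj_unique V x y : closed_subspace V -> is_orth_proj V x y ->
  orth_proj ip V x = y.
Proof.
move=> [_ VP _] [Vy xy].
have [Vp xp] : is_orth_proj V x (orth_proj ip V x).
  by rewrite /orth_proj; case: xgetP => [z ->//|/(_ y)[]].
set p := orth_proj ip V x in Vp xp *.
have Vd : V (p - y) by rewrite addrC -scaleN1r; exact: VP.
apply/eqP; rewrite -subr_eq0 -(dnorm_eq0 ip).
have -> : ip (p - y) (p - y) = ip (x - y) (p - y) - ip (x - p) (p - y).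
  by rewrite -linearBl/=; congr (ip _ _); rewrite opprB [RHS]addrC addrA subrK.
by rewrite xy// xp// subrr.
Qed.

Lemma dot_orth_proj V x y : proximinal V ->
  ip (orth_proj ip V x) y = ip (orth_proj ip V x) (orth_proj ip V y).
Proof.
move=> hV; have [Vx _] := orth_projP x hV; have [_ Vy] := orth_projP y hV.
by apply/eqP; rewrite -subr_eq0 -linearBr/= dotC Vy// rmorph0.
Qed.

Lemma dot_orth_proj_compl V x y : proximinal V ->
  ip (x - orth_proj ip V x) y =
  ip (x - orth_proj ip V x) (y - orth_proj ip V y).
Proof.
move=> hV; have [_ Vx] := orth_projP x hV; have [Vy _] := orth_projP y hV.
by rewrite [RHS]linearBr/= (Vx _ Vy) subr0.
Qed.

(** The other summands are orthogonal to W i, so that the component of a vector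
in W i is its projection there. *)
Lemma orth_sum_residual (I : choiceType) (D : {fset I}) (W : I -> set H) V
    (u : I -> H) i :
  orth_sum ip D W V -> (forall j, j \in D -> W j (u j)) -> i \in D ->
  is_orth_proj (W i) (\sum_(j <- D) u j) (u i).
Proof.
move=> [WD _] Wu iD; split; first exact: Wu.
move=> z Wz; rewrite (bigD1_seq i)//= addrC addrK linear_sumlz big_seq_cond.
rewrite big1// => j /andP[jD ji].
exact: (WD j i jD iD ji _ _ (Wu j jD) Wz).
Qed.

Lemma orth_sum_proximinal (I : choiceType) (D : {fset I}) (W : I -> set H) i :
  orth_sum ip D W [set: H] -> i \in D -> proximinal (W i).
Proof.
move=> WD iD x; have : [set: H] x by [].
rewrite {1}WD.2 => -[u Wu ->]; exists (u i); exact: orth_sum_residual WD Wu iD.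
Qed.

(** A vector of W i decomposes with all other components zero. *)
Lemma orth_sum_sub (I : choiceType) (D : {fset I}) (W : I -> set H) V i :
  (forall j, closed_subspace (W j)) -> orth_sum ip D W V -> i \in D ->
  W i `<=` V.
Proof.
move=> hW [_ ->] iD x Wx; exists (fun j => if j == i then x else 0).
  by move=> j _; case: eqP => [->//|_]; have [] := hW j.
rewrite (bigD1_seq i)//= eqxx big1 ?addr0// => j /negbTE ->//.
Qed.

(** The components of the projection of x on V are the projections of x itself:
x minus its i-th component is a vector orthogonal to V, hence to W i, plus the
other components. *)
Lemma orth_proj_sum (I : choiceType) (D : {fset I}) (W : I -> set H) V x :
  (forall j, closed_subspace (W j)) -> orth_sum ip D W V -> proximinal V ->
  orth_proj ip V x = \sum_(i <- D) orth_proj ip (W i) x.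
Proof.
move=> hW WD hV; have [Vp xp] := orth_projP x hV.
have : [set y | exists2 u : I -> H, (forall i, i \in D -> W i (u i)) &
    y = \sum_(i <- D) u i] (orth_proj ip V x) by rewrite -WD.2.
move=> [u Wu pE]; rewrite pE big_seq [RHS]big_seq; apply: eq_bigr => i iD.
apply/esym/orth_proj_unique => //; split; first exact: Wu.
move=> z Wz.
have -> : x - u i = (x - orth_proj ip V x) + (\sum_(j <- D) u j - u i).
  by rewrite -pE addrA subrK.
rewrite linearDl/= xp; last exact: orth_sum_sub WD iD _ Wz.
by rewrite add0r (orth_sum_residual WD Wu iD).2.
Qed.
End Projection.

(** * Refinement of a partition *)

Section Refinement.
Variables (T : rooted_tree) (N : nat) (L : {fset T}) (w : T).

(** A child of w in L would have its proper ancestor w in L as well. *)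
Lemma fdisjoint_ch :
  active_partition N L -> w \in L -> [disjoint L & ch w]%fset.
Proof.
move=> [_ anti _] wL; apply/fdisjointP => v vL; apply/negP => vw.
have wv : w = v by apply: anti => //; exists [:: v] => //=; rewrite vw.
by have := depth_ch vw; rewrite wv => /n_Sn.
Qed.

Lemma sum_refinement (V : zmodType) (f : T -> V) :
  active_partition N L -> w \in L ->
  \sum_(v <- L) f v - \sum_(v <- refinement L w) f v =
  f w - \sum_(v <- ch w) f v.
Proof.
move=> hL wL; have dis := fdisjoint_ch hL wL.
have -> : \sum_(v <- refinement L w) f v =
    \sum_(v <- (L `\ w)%fset) f v + \sum_(v <- ch w) f v.
  rewrite -big_cat; apply/perm_big/uniq_perm.
  - exact: fset_uniq.
  - rewrite cat_uniq !fset_uniq andbT/=; apply/hasPn => v vw /=.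
    by rewrite in_fsetD1; apply: contraL vw => /andP[_]; exact/fdisjointP.
  - by move=> v; rewrite mem_cat -in_fsetU.
by rewrite (big_fsetD1 w)//= opprD addrA addrK.
Qed.
End Refinement.

(** * Compressions *)

Section Compression.
Context {R : realType} {H : completeNormedModType R[i]}.
Variables (ip : {dot H for (@Num.conj R[i])}) (hH : norm_from_ip ip).
Variables (E : set H) (hE : orthonormal_basis ip E).
Variables (T : rooted_tree) (W : T -> set H) (A : H -> H).

Lemma dot_compression v x y : proximinal ip (W v) ->
  ip (compression ip W A v x) y =
  ip (orth_proj ip (W v) (sqrt_op ip A x))
     (orth_proj ip (W v) (sqrt_op ip A y)).
Proof.
move=> hv; rewrite /compression/=.
rewrite (positive_op_selfadjoint (positive_sqrt_op ip A)).
exact: dot_orth_proj.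
Qed.

Lemma compression_selfadjoint v x y : proximinal ip (W v) ->
  ip (compression ip W A v x) y = ip x (compression ip W A v y).
Proof.
by move=> hv; rewrite dot_compression// [RHS]dotC dot_compression// -dotC.
Qed.

Lemma sqrt_op_sum (K : Type) (r : seq K) (x : K -> H) :
  sqrt_op ip A (\sum_(k <- r) x k) = \sum_(k <- r) sqrt_op ip A (x k).
Proof.
have [Sb _] := positive_sqrt_op ip A.
elim: r => [|k r IHr]; first by rewrite !big_nil bounded_op0.
by rewrite !big_cons bounded_opD// IHr.
Qed.

(** With S = sqrt_op ip A, the operator S^2 is the sum of S P S and S (1 - P) S,
both with Gram kernels, so that it dominates the first of them. *)
Lemma hs_sum_compression v : proximinal ip (W v) -> (hs_sum ip E A < +oo)%E ->
  (hs_sum ip E (compression ip W A v) < +oo)%E.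
Proof.
move=> hv Ahs; apply: le_lt_trans (hs_sum_sqrt_op Ahs).
pose P := orth_proj ip (W v); pose S := sqrt_op ip A.
pose a (b : bool) x := if b then P (S x) else S x - P (S x).
have Ssa := positive_op_selfadjoint (positive_sqrt_op ip A).
have := @hs_sum_superadditive _ _ _ hH _ hE _ [:: true; false]
  (fun b => S \o a b) a (S \o S).
rewrite !big_cons big_nil adde0 => le; apply: le_trans (le _ _).
- by rewrite leeDl// hs_sum_ge0.
- move=> [] x y /=; rewrite Ssa; first exact: dot_orth_proj.
  exact: dot_orth_proj_compl.
- move=> x; rewrite -(@sqrt_op_sum _ [:: true; false] (a^~ x)).
  by rewrite !big_cons big_nil /= addr0 addrC subrK.
Qed.

Lemma compression_sum v x :
  (forall u, closed_subspace (W u)) -> orth_sum ip (ch v) W (W v) ->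
  proximinal ip (W v) ->
  compression ip W A v x = \sum_(u <- ch v) compression ip W A u x.
Proof.
move=> hW hv pv.
by rewrite /compression/= (orth_proj_sum _ hW hv pv) sqrt_op_sum.
Qed.
End Compression.

(** * The energy drop *)

Theorem theorem6p4 (R : realType) (H : completeNormedModType R[i])
  (ip : {dot H for (@Num.conj R[i])}) (hH : norm_from_ip ip)
  (E : set H) (hE : orthonormal_basis ip E)
  (T : rooted_tree) (W : T -> set H)
  (hW : forall w : T, closed_subspace (W w))
  (hlevel : forall n : nat, orth_sum ip (level T n) W [set: H])
  (hch : forall w : T, orth_sum ip (ch w) W (W w))
  (N : nat) (hN : (1 <= N)%N)
  (L : {fset T}) (hL : active_partition N L)
  (w : T) (hwL : w \in L) (hwN : (depth w < N)%N)
  (A : H -> H) (hA : positive_op ip A) (hA2 : hilbert_schmidt ip E A) :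
  [/\ energy ip E W A L - energy ip E W A (refinement L w)
        = energy_drop ip E W A w,
      (energy_drop ip E W A w)%:C
        = \sum_(v <- ch w) \sum_(v' <- ch w | v != v')
            trace ip E (compression ip W A v \o compression ip W A v'),
      0 <= \sum_(v <- ch w) \sum_(v' <- ch w | v != v')
            trace ip E (compression ip W A v \o compression ip W A v')
    & energy ip E W A (refinement L w) <= energy ip E W A L].
Proof.
have prox v : proximinal ip (W v).
  by apply: (orth_sum_proximinal (hlevel (depth v))); rewrite in_level.
have hs v : (hs_sum ip E (compression ip W A v) < +oo)%E.
  by apply: hs_sum_compression => //; case: hA2.
have split_w x :
    compression ip W A w x = \sum_(v <- ch w) compression ip W A v x.
  exact: compression_sum.
have energyE : energy ip E W A L - energy ip E W A (refinement L w)
    = energy_drop ip E W A w by exact: (sum_refinement _ hL hwL).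
have dropE : (energy_drop ip E W A w)%:C
    = \sum_(v <- ch w) \sum_(v' <- ch w | v != v')
        trace ip E (compression ip W A v \o compression ip W A v').
  apply: hs_norm_sum_sub (hs w) => //.
  by move=> v x y; apply: compression_selfadjoint.
have drop_ge0 : 0 <= energy_drop ip E W A w.
  rewrite /energy_drop subr_ge0 sqr_hs_norm.
  under eq_bigr do rewrite sqr_hs_norm.
  rewrite sum_fine; last by move=> v _; rewrite ge0_fin_numE// hs_sum_ge0.
  have le : (\sum_(v <- ch w) hs_sum ip E (compression ip W A v) <=
      hs_sum ip E (compression ip W A w))%E.
    by apply: hs_sum_superadditive split_w => // v x y; exact: dot_compression.
  rewrite fine_le//.
    by apply/sum_fin_numP => v _ _; rewrite ge0_fin_numE// hs_sum_ge0.
  by rewrite ge0_fin_numE// hs_sum_ge0.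
split=> //; first by rewrite -dropE ler0c.
by rewrite -subr_ge0 energyE.
Qed.
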